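(* Let $(Z,\mathcal{M})$ be a complete ultrametric Möbius space. If $X$ and $X'$ are nonelementary geodesically complete trees such that $(\partial_\infty X,\mathcal{M}_X)$ and $(\partial_\infty X',\mathcal{M}_{X'})$ are both Möbius equivalent to $(Z,\mathcal{M})$, then $X$ and $X'$ are isometric.
   Context: **Extended metrics.** Let $Z$ be a set with $|Z|\ge 3$. An extended metric on $Z$ is a symmetric map $\rho:Z\times Z\to[0,\infty]$ such that there is a set $\Omega(\rho)\subset Z$ with $|\Omega(\rho)|\in\{0,1\}$, such that $\rho$ restricted to $Z\setminus\Omega(\rho)$ is a metric (with finite values), $\rho(z,\omega)=\infty$ for $z\in Z\setminus\Omega(\rho)$, $\omega\in\Omega(\rho)$, and $\rho(\omega,\omega)=0$ for $\omega \in\Omega(\rho)$. If $\Omega(\rho)=\{\omega\}$, $\omega$ is called the (infinitely) remote point. Write $Z_\omega=Z\setminus\Omega(\rho)$. $(Z,\rho)$ is complete if every Cauchy sequence of the metric space $Z_\omega$ converges in $Z_\omega$ and, in case $Z_\omega$ is unbounded, the remote point exists. **Cross ratio triple.** A quadruple $(x,y,z,w)\in Z^4$ is admissible if no entry occurs three or four times. Its cross ratio triple is the point $$\mathrm{crt}_\rho(x,y,z,w)=(\rho(x,y)\rho(z,w):\rho(x,z)\rho(y,w):\rho(x,w)\rho(y,z))\in\mathbb{R}P^2,$$ with the conventions: if the remote point occurs exactly once, the three (infinite) factors containing it are cancelled, e.g. $\mathrm{crt}_\rho(x,y,z,\omega)=(\rho(x,y):\rho(x,z):\rho(y,z))$;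 if it occurs twice, the entry in which it is paired with itself is $0$ and the other two entries are equal, e.g. $\mathrm{crt}_\rho(x,y,\omega,\omega)=(0:1:1)$. **Möbius spaces.** Two extended metrics on $Z$ are Möbius equivalent if they have the same cross ratio triple on all admissible quadruples. A Möbius structure $\mathcal{M}$ on $Z$ is an equivalence class of Möbius equivalent extended metrics on $Z$; a Möbius space is a pair $(Z,\mathcal{M})$ with $|Z|\ge3$. Put $\mathrm{crt}=\mathrm{crt}_\rho$ for any $\rho\in\mathcal{M}$. A map between Möbius spaces is Möbius if it is injective and preserves the cross ratio triple of all admissible quadruples; two Möbius spaces are Möbius equivalent if there is a bijective Möbius map between them. $(Z,\mathcal{M})$ is complete if $(Z,\rho)$ is complete for $\rho\in\mathcal{M}$ (this does not depend on the choice of $\rho\in\mathcal M$). A point $(a:b:c)$ with $a,b,c\ge0$ is ultrametric if the two largest of $a,b,c$ coincide; $(Z,\mathcal{M})$ is ultrametric if $\mathrm{crt}(x,y,z,w)$ is ultrametric for all admissible quadruples. **Trees.** A tree is a metric space $(X,d)$, $|xy|:=d(x,y)$, such that (1) any $x,y\in X$ are joined by a unique isometric map $c:[0,d(x,y)]\to X$ with $c(0)=x$, $c(d(x,y))=y$, with image denoted $[x,y]$; (2) if $[x,y]\cap[y,z]=\{y\}$ then $[x,z]=[x,y]\cup[y,z]$. It is geodesically complete if every isometric map $[0,\ell]\to X$, $\ell>0$, extends to an isometric map $\mathbb{R}\to X$ (isometric map means distance preserving). **Boundary.** For $x,y,o\in X$ let $(x|y)_o=\frac12(|ox|+|oy|-|xy|)$.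 A sequence $(x_i)$ in $X$ is a Gromov sequence if $(x_i|x_j)_o\to\infty$ as $i,j\to\infty$ (for some base point $o\in X$); two Gromov sequences are equivalent if $(x_i|y_i)_o\to\infty$. $\partial_\infty X$ is the set of equivalence classes. $X$ is nonelementary if $|\partial_\infty X|\ge3$. For $a\ne b$ in $\partial_\infty X$ let $(a|b)_x=\lim_i(a_i|b_i)_x$ for sequences $(a_i),(b_i)$ representing $a,b$ (well defined). The Bourdon metric at $x\in X$ is $\rho_x(a,b)=e^{-(a|b)_x}$ for $a\neq b$, $\rho_x(a,a)=0$. All $\rho_x$, $x\in X$, are Möbius equivalent ultrametrics on $\partial_\infty X$; for $X$ nonelementary, $\mathcal{M}_X$ denotes the Möbius structure on $\partial_\infty X$ containing them (the canonical Möbius structure). *)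

(* Defs.v *)
From HB Require Import structures.
From mathcomp Require Import all_boot all_order all_algebra.
From mathcomp Require Import all_classical all_reals all_analysis.

Set Implicit Arguments.
Unset Strict Implicit.
Unset Printing Implicit Defensive.

Import Order.TTheory GRing.Theory Num.Theory.
Import numFieldNormedType.Exports.

Local Open Scope classical_set_scope.
Local Open Scope ring_scope.

Section ExtendedMetrics.
Context {R : realType} {Z : Type}.
Implicit Types (rho : Z -> Z -> \bar R) (Omega : set Z).

Definition is_metric_on (D : set Z) rho : Prop :=
  [/\ forall x y, D x -> D y -> (rho x y < +oo)%E,
      forall x y, D x -> D y -> (rho x y = 0%E <-> x = y) &
      forall x y z, D x -> D y -> D z -> (rho x z <= rho x y + rho y z)%E].

Definition is_remote_set rho Omega : Prop :=
  [/\ Omega = set0 \/ (exists w, Omega = [set w]),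
      is_metric_on (~` Omega) rho,
      forall z w, ~ Omega z -> Omega w -> rho z w = +oo%E &
      forall w, Omega w -> rho w w = 0%E].

Definition extended_metric rho : Prop :=
  [/\ forall x y, rho x y = rho y x,
      forall x y, (0 <= rho x y)%E &
      exists Omega, is_remote_set rho Omega].

Definition cauchy_sequence rho (u : nat -> Z) : Prop :=
  forall e : R, 0 < e ->
  exists N : nat, forall i j : nat,
    (N <= i)%N -> (N <= j)%N -> (rho (u i) (u j) < e%:E)%E.

Definition converges_to rho (u : nat -> Z) (z : Z) : Prop :=
  forall e : R, 0 < e ->
  exists N : nat, forall i : nat, (N <= i)%N -> (rho (u i) z < e%:E)%E.

Definition bounded_in rho (D : set Z) : Prop :=
  exists C : R, forall x y, D x -> D y -> (rho x y <= C%:E)%E.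

(* Omega is unique as soon as Z has at least three points: two points outside
   a remote set are at finite distance from each other. *)
Definition complete_extended_metric rho : Prop :=
  exists Omega, [/\ is_remote_set rho Omega,
    forall u : nat -> Z, (forall i, ~ Omega (u i)) -> cauchy_sequence rho u ->
      exists2 z, ~ Omega z & converges_to rho u z &
    ~ bounded_in rho (~` Omega) -> exists w, Omega w].

Definition admissible (x y z w : Z) : Prop :=
  [/\ ~ (x = y /\ y = z), ~ (x = y /\ y = w),
      ~ (x = z /\ z = w) & ~ (y = z /\ z = w)].

(* Cancelling the infinite factors amounts to replacing each of them by 1.  On
   an admissible quadruple each of the three products has exactly one infinite
   factor if the remote point w occurs once; if it occurs twice, the product
   containing rho w w = 0 vanishes and the other two become 1 * 1. *)
Definition crt_factor rho (x y : Z) : R :=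
  if rho x y == +oo%E then 1 else fine (rho x y).

Definition crt rho (x y z w : Z) : R * R * R :=
  (crt_factor rho x y * crt_factor rho z w,
   crt_factor rho x z * crt_factor rho y w,
   crt_factor rho x w * crt_factor rho y z).

End ExtendedMetrics.

(* Triples are homogeneous coordinates: equality of points of the projective
   plane is equality of coordinates up to a nonzero scalar. *)
Definition proj_eq {R : realType} (p q : R * R * R) : Prop :=
  exists2 l : R, l != 0 &
    q = (l * p.1.1, l * p.1.2, l * p.2).

(* The two largest of the (nonnegative) coordinates coincide. *)
Definition ultrametric_point {R : realType} (p : R * R * R) : Prop :=
  let: (a, b, c) := p in
  [\/ a = b /\ c <= a, a = c /\ b <= a | b = c /\ a <= b].

Section MoebiusStructures.
Context {R : realType} {Z : Type}.
Implicit Types (rho : Z -> Z -> \bar R) (M : set (Z -> Z -> \bar R)).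

Definition moebius_equivalent_metrics rho rho' : Prop :=
  forall x y z w, admissible x y z w ->
    proj_eq (crt rho x y z w) (crt rho' x y z w).

Definition moebius_class rho : set (Z -> Z -> \bar R) :=
  [set rho' | extended_metric rho' /\ moebius_equivalent_metrics rho rho'].

Definition at_least_three_points (T : Type) : Prop :=
  exists a b c : T, [/\ a <> b, a <> c & b <> c].

Definition moebius_space M : Prop :=
  at_least_three_points Z /\
  exists2 rho, extended_metric rho & M = moebius_class rho.

Definition complete_moebius M : Prop :=
  forall rho, M rho -> complete_extended_metric rho.

Definition ultrametric_moebius M : Prop :=
  forall rho, M rho -> forall x y z w, admissible x y z w ->
    ultrametric_point (crt rho x y z w).

End MoebiusStructures.

Definition moebius_map {R : realType} {Z Z' : Type}
    (M : set (Z -> Z -> \bar R)) (M' : set (Z' -> Z' -> \bar R))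
    (f : Z -> Z') : Prop :=
  injective f /\
  forall rho rho', M rho -> M' rho' ->
  forall x y z w, admissible x y z w ->
    proj_eq (crt rho x y z w) (crt rho' (f x) (f y) (f z) (f w)).

Definition moebius_equivalent_spaces {R : realType} {Z Z' : Type}
    (M : set (Z -> Z -> \bar R)) (M' : set (Z' -> Z' -> \bar R)) : Prop :=
  exists2 f : Z -> Z', bijective f & moebius_map M M' f.

Section Trees.
Context {R : realType} (X : metricType R).

Definition isometric_on (D : set R) (c : R -> X) : Prop :=
  forall s t, D s -> D t -> mdist (c s) (c t) = `|s - t|.

(* c is only relevant on [0, mdist x y]. *)
Definition is_geodesic (x y : X) (c : R -> X) : Prop :=
  [/\ isometric_on `[0, mdist x y] c, c 0 = x & c (mdist x y) = y].

Definition segment (x y : X) : set X :=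
  [set p | exists2 c, is_geodesic x y c & (c @` `[0, mdist x y]) p].

Definition tree : Prop :=
  [/\ forall x y : X, exists c, is_geodesic x y c,
      forall (x y : X) c c', is_geodesic x y c -> is_geodesic x y c' ->
        {in `[0, mdist x y], c =1 c'} &
      forall x y z : X, segment x y `&` segment y z = [set y] ->
        segment x z = segment x y `|` segment y z].

Definition geodesically_complete : Prop :=
  forall (l : R) (c : R -> X), 0 < l -> isometric_on `[0, l] c ->
    exists2 g : R -> X, isometric_on setT g & {in `[0, l], g =1 c}.

Definition gromov_product (o x y : X) : R :=
  (mdist o x + mdist o y - mdist x y) / 2.

Definition gromov_sequence (u : nat -> X) : Prop :=
  exists o : X, forall A : R, exists N : nat, forall i j : nat,
    (N <= i)%N -> (N <= j)%N -> A <= gromov_product o (u i) (u j).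

Definition gromov_equivalent (u v : nat -> X) : Prop :=
  exists o : X, (fun i => gromov_product o (u i) (v i)) @ \oo --> +oo.

Definition gromov_class (u : nat -> X) : set (nat -> X) :=
  [set v | gromov_sequence v /\ gromov_equivalent u v].

Definition boundary : Type :=
  {a : set (nat -> X) | exists2 u, gromov_sequence u & a = gromov_class u}.

Definition nonelementary : Prop := at_least_three_points boundary.

Definition boundary_repr (a : boundary) : nat -> X :=
  s2val (cid2 (svalP a)).

(* For a <> b in the boundary of a tree the limit exists and does not depend on
   the representing sequences. *)
Definition boundary_product (x : X) (a b : boundary) : R :=
  lim ((fun i => gromov_product x (boundary_repr a i) (boundary_repr b i))
       @ \oo).

Definition bourdon (x : X) (a b : boundary) : \bar R :=
  if `[< a = b >] then 0%E else (expR (- boundary_product x a b))%:E.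

(* The bourdon x are pairwise Moebius equivalent, so that this is the union of
   copies of a single class. *)
Definition canonical_moebius : set (boundary -> boundary -> \bar R) :=
  \bigcup_(x in [set: X]) moebius_class (bourdon x).

End Trees.

Arguments boundary {R} X.
Arguments nonelementary {R} X.
Arguments canonical_moebius {R} X.

Definition isometric_spaces {R : realType} (X X' : metricType R) : Prop :=
  exists2 f : X -> X', bijective f &
    forall x y, mdist (f x) (f y) = mdist x y.

(* Main.v *)
Require Import Defs.
From mathcomp Require Import all_boot all_order all_algebra.
From mathcomp Require Import all_classical all_reals all_analysis.
From mathcomp Require Import lra.

Set Implicit Arguments.
Unset Strict Implicit.
Unset Printing Implicit Defensive.

Import Order.TTheory GRing.Theory Num.Theory.
Import numFieldNormedType.Exports.

Local Open Scope classical_set_scope.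
Local Open Scope ring_scope.

(** Write (a|b)_x for the Gromov product of two ends seen from x, so that the
    Bourdon metric at x is e^{-(a|b)_x}.  A nonelementary geodesically complete
    tree can be recovered from the functions (a|b)_x on pairs of distinct ends,
    and these functions are governed by the cross ratios.

    Trees are 0-hyperbolic ([four_point]), hence along representing sequences
    the products (a_i|b_i)_x are eventually equal to (a|b)_x
    ([boundary_product_near]), and every identity or inequality between finitely
    many distances passes to the boundary at once.  Two consequences carry the
    proof.

    - Distances are visible from the boundary.  For distinct ends a, b, c the
      quantity T_x(a,b,c) = (a|b)_x + (a|c)_x - (b|c)_x changes between x and y
      by the Busemann function of a, so T_y - T_x <= d(x,y); prolonging the
      segment from y to x beyond x gives an end a for which equality holds
      ([boundary_product_triple_le], [boundary_product_triple_eq]).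

    - Points are determined by little data.  Every x lies on a line, that is,
      (a|b)_x = 0 for some ends a and b ([boundary_product_exists0]).  Then, by
      the ultrametric inequality, the smaller of (a|u)_x and (b|u)_x is 0 for
      every other end u, so these two products are known as soon as their
      difference is; moreover the value of (a|c)_x - (b|c)_x for one third end c
      can be prescribed arbitrarily by moving x along the line
      ([boundary_product_line]).

    Let F be the bijection of the boundaries induced by the two Moebius
    equivalences; it preserves (a|b) + (c|d) - (a|c) - (b|d), minus the logarithm of a
    quotient of coordinates of the cross ratio triple.  Given x on the line from
    a to b, choose x' on the line from F a to F b with the same value of
    (a|c) - (b|c).  Preservation of cross ratios then forces
    (F u|F v)_x' = (u|v)_x for all distinct u and v ([corresponds_exists]).  The
    correspondence x -> x' preserves distances because these are expressed by
    Gromov products of ends, and the inverse of F provides its inverse. *)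

(** * Trees are 0-hyperbolic *)

Section GromovProduct.
Context {R : realType} {X : metricType R}.
Implicit Types (o p x y z w : X).

Lemma gromov_productC o x y : gromov_product o x y = gromov_product o y x.
Proof. by rewrite /gromov_product (metric_sym x y); lra. Qed.

Lemma gromov_product_ge0 o x y : 0 <= gromov_product o x y.
Proof.
have := metric_triangle x o y; rewrite (metric_sym x o) /gromov_product; lra.
Qed.

Lemma gromov_product_le o x y : gromov_product o x y <= mdist o x.
Proof. have := metric_triangle o x y; rewrite /gromov_product; lra. Qed.

Lemma gromov_product_base o p x y :
  gromov_product o x y <= gromov_product p x y + mdist o p.
Proof.
have := metric_triangle o p x; have := metric_triangle o p y.
by rewrite /gromov_product; lra.
Qed.

Lemma geodesicP x y c : is_geodesic x y c <->
  [/\ forall s t, 0 <= s <= mdist x y -> 0 <= t <= mdist x y ->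
        mdist (c s) (c t) = `|s - t|,
      c 0 = x & c (mdist x y) = y].
Proof. by split=> -[hc h0 h1]; split. Qed.

Lemma geodesic_dist x y c t : is_geodesic x y c -> 0 <= t <= mdist x y ->
  mdist x (c t) = t.
Proof.
move=> /geodesicP[hc h0 _] /andP[t0 t1].
by rewrite -{1}h0 hc ?t0 ?t1 ?lexx ?mdist_ge0// sub0r normrN ger0_norm.
Qed.

Lemma geodesic_dist_end x y c t : is_geodesic x y c -> 0 <= t <= mdist x y ->
  mdist (c t) y = mdist x y - t.
Proof.
move=> /geodesicP[hc _ h1] /andP[t0 t1].
rewrite -{1}h1 hc ?t0 ?t1 ?lexx ?mdist_ge0//.
by rewrite distrC ger0_norm// subr_ge0.
Qed.

Lemma geodesic_initial x y c t : is_geodesic x y c -> 0 <= t <= mdist x y ->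
  is_geodesic x (c t) c.
Proof.
move=> gc ht; have e := geodesic_dist gc ht.
move: gc ht => /geodesicP[hc h0 h1] /andP[t0 t1].
by apply/geodesicP; rewrite e; split=> // u v /andP[? ?] /andP[? ?]; apply: hc;
  lra.
Qed.

Lemma geodesic_final x y c t : is_geodesic x y c -> 0 <= t <= mdist x y ->
  is_geodesic (c t) y (fun s => c (t + s)).
Proof.
move=> gc ht; have e := geodesic_dist_end gc ht.
move: gc ht => /geodesicP[hc h0 h1] /andP[t0 t1].
apply/geodesicP; rewrite e; split; last 2 first.
- by rewrite addr0.
- by rewrite addrC subrK.
move=> u v /andP[? ?] /andP[? ?]; rewrite hc; [|lra|lra].
by congr `|_|; lra.
Qed.

Lemma geodesic_rev x y c : is_geodesic x y c ->
  is_geodesic y x (fun s => c (mdist x y - s)).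
Proof.
move=> /geodesicP[hc h0 h1]; apply/geodesicP; rewrite metric_sym; split.
- move=> s t hs ht; rewrite hc; [|lra|lra].
  by rewrite distrC; congr `|_|; lra.
- by rewrite subr0.
- by rewrite subrr.
Qed.

(** By uniqueness of geodesics a point of a segment lies on any given
    geodesic. *)
Lemma segmentP x y p : tree X -> segment x y p <->
  forall c, is_geodesic x y c -> exists2 t, 0 <= t <= mdist x y & c t = p.
Proof.
move=> [ex un _]; split.
  move=> [c gc [t /=]]; rewrite in_itv /= => ht <- c' gc'.
  by exists t => //; apply: (un x y) => //; rewrite in_itv.
move=> h; have [c gc] := ex x y; exists c => //.
by have [t ht <-] := h _ gc; exists t => //=; rewrite in_itv.
Qed.

Lemma segment_dist x y p : segment x y p ->
  mdist x y = mdist x p + mdist p y.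
Proof.
move=> [c gc [t /=]]; rewrite in_itv /= => ht <-.
by rewrite (geodesic_dist gc ht) (geodesic_dist_end gc ht); lra.
Qed.

Hypothesis hX : tree X.

Lemma geodesics_agree x y z c c' t :
  is_geodesic x y c -> is_geodesic x z c' ->
  0 <= t <= mdist x y -> t <= mdist x z -> c t = c' t ->
  forall s, 0 <= s <= t -> c s = c' s.
Proof.
move=> gc gc' ht ht' e s hs; have [_ un _] := hX.
have g1 := geodesic_initial gc ht.
have g2 : is_geodesic x (c t) c' by rewrite e; apply: (geodesic_initial gc'); lra.
by apply: (un _ _ _ _ g1 g2); rewrite in_itv /= (geodesic_dist gc).
Qed.

(** Two geodesics issuing from x separate exactly at distance (y|z)_x: the two
    remaining pieces meet only at the separation point, so that their union is
    the segment from y to z. *)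
Lemma geodesics_split x y z c c' :
  is_geodesic x y c -> is_geodesic x z c' ->
  c (gromov_product x y z) = c' (gromov_product x y z).
Proof.
move=> gc gc'; have [ex un glue] := hX.
pose S := [set t : R | [/\ 0 <= t, t <= mdist x y, t <= mdist x z & c t = c' t]].
have S0 : S 0.
  split; rewrite ?mdist_ge0 //.
  by move: gc gc' => [_ -> _] [_ -> _].
have Sub : has_ubound S by exists (mdist x y) => t [].
have Sne : S !=set0 by exists 0.
pose t0 := sup S.
have t0ge : 0 <= t0 by apply: ub_le_sup.
have t0y : t0 <= mdist x y by apply: ge_sup => // t [].
have t0z : t0 <= mdist x z by apply: ge_sup => // t [].
have [hc c0 c1] := (geodesicP x y c).1 gc.
have [hc' c0' c1'] := (geodesicP x z c').1 gc'.
(* The supremum is attained, by continuity. *)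
have et0 : c t0 = c' t0.
  apply/mdist_positivity/le_anti; rewrite mdist_ge0 andbT.
  apply/ler_addgt0Pr => e e0; rewrite add0r.
  have e2 : 0 < e / 2 by lra.
  have [t [t1 t2 t3 et] tt] := sup_adherent e2 (conj Sne Sub).
  have tle : t <= t0 by apply: ub_le_sup.
  have := metric_triangle (c t0) (c t) (c' t0).
  rewrite {2}et hc ?hc' ?t0ge ?t1 ?t2 ?t3 ?t0y ?t0z //.
  rewrite ger0_norm ?ler0_norm; [|lra|lra]; move: tt; rewrite -/t0; lra.
(* Beyond t0 the geodesics are disjoint, so m lies between y and z. *)
pose m := c t0.
have gmy := geodesic_final gc (t := t0); have gmz := geodesic_final gc' (t := t0).
have htm : segment y z m.
  rewrite (glue y m z); first by left; apply/segmentP => // g gg;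
    exists (mdist y m); rewrite ?mdist_ge0 ?lexx//; case: gg.
  apply/seteqP; split=> p /=; last first.
    move=> ->; split; apply/segmentP => // g gg.
      by exists (mdist y m); rewrite ?mdist_ge0 ?lexx//; case: gg.
    by exists 0; rewrite ?mdist_ge0 ?lexx//; case: gg.
  move=> [/segmentP-/(_ hX) h1 /segmentP-/(_ hX) h2].
  have [|s hs es] := h1 _ (geodesic_rev (gmy _)); first by rewrite t0ge.
  have [|s' hs' es'] := h2 (fun s => c' (t0 + s)).
    by rewrite /m et0; apply: gmz; rewrite t0ge.
  have e1 : mdist m y = mdist x y - t0.
    by rewrite (geodesic_dist_end gc) ?t0ge.
  have e2 : mdist m z = mdist x z - t0.
    by rewrite /m et0 (geodesic_dist_end gc') ?t0ge.
  rewrite -/m in es hs; rewrite metric_sym in hs; rewrite e1 in es hs.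
  rewrite e2 in hs'.
  have d1 : mdist x p = mdist x y - s.
    by rewrite -es (geodesic_dist gc); lra.
  have d2 : mdist x p = t0 + s'.
    by rewrite -es' (geodesic_dist gc')//; lra.
  have Ssp : S (t0 + s').
    split; [lra|lra|lra|].
    by rewrite es' -es; congr c; lra.
  have := ub_le_sup Sub Ssp; rewrite -/t0 => lt.
  by rewrite -es /m; congr c; lra.
have := segment_dist htm.
rewrite (metric_sym y m) (geodesic_dist_end gc) ?t0ge //.
rewrite /m et0 (geodesic_dist_end gc') ?t0ge // => dyz.
suff -> : gromov_product x y z = t0 by [].
by rewrite /gromov_product dyz; lra.
Qed.

(** The geodesics to x and y agree up to (x|y), those to y and z up to (y|z);
    hence those to x and z agree up to the smaller of the two values. *)
Lemma four_point o x y z :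
  Num.min (gromov_product o x y) (gromov_product o y z) <= gromov_product o x z.
Proof.
have [ex un _] := hX.
have [cx gx] := ex o x; have [cy gy] := ex o y; have [cz gz] := ex o z.
have exy := geodesics_split gx gy; have eyz := geodesics_split gy gz.
have bx := gromov_product_le o x y; have bz := gromov_product_le o z y.
have b1 := gromov_product_le o y x; have b2 := gromov_product_le o y z.
have p1 := gromov_product_ge0 o x y; have p2 := gromov_product_ge0 o y z.
rewrite (gromov_productC o y x) in b1; rewrite (gromov_productC o z y) in bz.
set t := Num.min _ _.
have t0 : 0 <= t by rewrite le_min p1.
have tl : t <= gromov_product o x y by rewrite ge_min lexx.
have tr : t <= gromov_product o y z by rewrite ge_min lexx orbT.
have e : cx t = cz t.
  rewrite (geodesics_agree gx gy _ _ exy); [|lra..].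
  by rewrite (geodesics_agree gy gz _ _ eyz); [|lra..].
have := metric_triangle x (cx t) z.
rewrite (metric_sym x (cx t)) (geodesic_dist_end gx); last lra.
rewrite e (geodesic_dist_end gz); last lra.
by rewrite /gromov_product; lra.
Qed.

End GromovProduct.

(** * Gromov products on the boundary *)

Section Boundary.
Context {R : realType} {X : metricType R} (hX : tree X).
Implicit Types (o p x y z : X) (u v w : nat -> X) (a b c : boundary X).

(** Replacing x and y by points that are closer to them, as seen from p, than x
    is to y does not affect the product. *)
Lemma gromov_product_stable p x x' y y' :
  gromov_product p x y < gromov_product p x x' ->
  gromov_product p x y < gromov_product p y y' ->
  gromov_product p x' y' = gromov_product p x y.
Proof.
move=> hx hy.
have h1 := four_point hX p x x' y; have h2 := four_point hX p x' y' y.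
have h3 := four_point hX p x' x y; have h4 := four_point hX p x' y y'.
rewrite !ge_min in h1 h2 h3 h4.
rewrite (gromov_productC p y' y) in h2; rewrite (gromov_productC p x' x) in h3.
apply/le_anti/andP; split.
  by case/orP: h1 => ?; case/orP: h2 => ?; lra.
by case/orP: h3 => ?; case/orP: h4 => ?; lra.
Qed.

Lemma gromov_sequence_ge u x A : gromov_sequence u ->
  exists N, forall i j, (N <= i)%N -> (N <= j)%N ->
    A <= gromov_product x (u i) (u j).
Proof.
move=> [p hu]; have [N hN] := hu (A + mdist p x).
exists N => i j Ni Nj; have := hN _ _ Ni Nj.
by have := gromov_product_base p x (u i) (u j); lra.
Qed.

Lemma gromov_equivalent_ge u v x A : gromov_equivalent u v ->
  \forall i \near \oo, A <= gromov_product x (u i) (v i).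
Proof.
move=> [p /cvgryPge-/(_ (A + mdist p x))]; apply: filterS => i.
by have := gromov_product_base p x (u i) (v i); lra.
Qed.

Lemma gromov_equivalentI u v x :
  (forall A, \forall i \near \oo, A <= gromov_product x (u i) (v i)) ->
  gromov_equivalent u v.
Proof. by move=> h; exists x; apply/cvgryPge. Qed.

Lemma gromov_equivalentC u v : gromov_equivalent u v -> gromov_equivalent v u.
Proof.
move=> uv; apply: (@gromov_equivalentI _ _ (u 0%N)) => A.
by apply: filterS (gromov_equivalent_ge (u 0%N) A uv) => i;
  rewrite gromov_productC.
Qed.

Lemma gromov_equivalent_trans u v w : gromov_equivalent u v ->
  gromov_equivalent v w -> gromov_equivalent u w.
Proof.
move=> uv vw; apply: (@gromov_equivalentI _ _ (u 0%N)) => A.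
apply: filterS2 (gromov_equivalent_ge (u 0%N) A uv)
  (gromov_equivalent_ge (u 0%N) A vw) => i h1 h2.
by apply: le_trans (four_point hX _ _ (v i) _); rewrite le_min h1.
Qed.

Lemma gromov_class_eq u v : gromov_equivalent u v ->
  gromov_class u = gromov_class v.
Proof.
move=> uv; apply/seteqP; split=> w [hw uw]; split=> //.
  exact: gromov_equivalent_trans (gromov_equivalentC uv) uw.
exact: gromov_equivalent_trans uv uw.
Qed.

Lemma boundary_repr_gromov a : gromov_sequence (boundary_repr a).
Proof. by rewrite /boundary_repr; case: cid2. Qed.

Lemma boundary_repr_class a : sval a = gromov_class (boundary_repr a).
Proof. by rewrite /boundary_repr; case: cid2. Qed.

Lemma boundary_repr_ge a x A : \forall i \near \oo, forall j, (i <= j)%N ->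
  A <= gromov_product x (boundary_repr a i) (boundary_repr a j).
Proof.
have [N hN] := gromov_sequence_ge x A (boundary_repr_gromov a).
exists N => // i /= Ni j ij; apply: hN => //; exact: leq_trans ij.
Qed.

Lemma boundary_eq a b :
  gromov_equivalent (boundary_repr a) (boundary_repr b) -> a = b.
Proof.
move=> /gromov_class_eq; rewrite -!boundary_repr_class.
by case: a b => [a ha] [b hb] /= e; apply: eq_exist.
Qed.

(** Every Gromov sequence converges to some end, in terms of the chosen
    representative of this end. *)
Lemma boundary_end u x : gromov_sequence u ->
  exists a, forall A, \forall i \near \oo,
    A <= gromov_product x (u i) (boundary_repr a i).
Proof.
move=> hu; pose a : boundary X := exist _ _ (ex_intro2 _ _ u hu erefl).
exists a => A; apply: gromov_equivalent_ge.
suff [] : gromov_class u (boundary_repr a) by [].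
rewrite -[gromov_class u]/(sval a) boundary_repr_class.
split; first exact: boundary_repr_gromov.
apply: (@gromov_equivalentI _ _ x) => B.
by apply: filterS (boundary_repr_ge a x B) => i; apply.
Qed.

Lemma boundary_product_near a b x : a <> b -> \forall i \near \oo,
  gromov_product x (boundary_repr a i) (boundary_repr b i) =
  boundary_product x a b.
Proof.
move=> nab.
pose ab i := gromov_product x (boundary_repr a i) (boundary_repr b i).
(* The sequences are not equivalent, so the products stay below some A along a
   subsequence. *)
have [A hA] : exists A, forall N, exists2 i, (N <= i)%N & ab i < A.
  apply: contrapT => h; apply/nab/boundary_eq/(@gromov_equivalentI _ _ x) => A.
  apply: contrapT => h'; apply: h; exists A => N; apply: contrapT => h''.
  apply: h'; exists N => // i /= Ni; rewrite leNgt; apply/negP => lt.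
  by apply: h''; exists i.
have [i [ai bi]] : exists i, (forall j, (i <= j)%N ->
    ab i < gromov_product x (boundary_repr a i) (boundary_repr a j)) /\
    (forall j, (i <= j)%N ->
    ab i < gromov_product x (boundary_repr b i) (boundary_repr b j)).
  have [N _ hN] := filterI (boundary_repr_ge a x A) (boundary_repr_ge b x A).
  have [i Ni lt] := hA N; exists i; have [h1 h2] := hN i Ni.
  by split=> j ij; [have := h1 j ij|have := h2 j ij]; lra.
have e : \forall j \near \oo, ab j = ab i.
  by exists i => // j /= ij; apply: gromov_product_stable; [exact: ai|exact: bi].
rewrite /boundary_product (lim_near_cst (@Rhausdorff R) e).
exact: e.
Qed.

Lemma boundary_productC x a b : boundary_product x a b = boundary_product x b a.
Proof.
by rewrite /boundary_product; under eq_fun do rewrite gromov_productC.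
Qed.

Lemma boundary_product_ge0 x a b : a <> b -> 0 <= boundary_product x a b.
Proof.
move=> /(boundary_product_near x) h; near \oo => i.
suff <- : gromov_product x (boundary_repr a i) (boundary_repr b i) =
  boundary_product x a b by exact: gromov_product_ge0.
by near: i.
Unshelve. all: by end_near. Qed.

Lemma boundary_product_ultra x a b c : a <> b -> b <> c -> a <> c ->
  Num.min (boundary_product x a b) (boundary_product x b c)
    <= boundary_product x a c.
Proof.
move=> /(boundary_product_near x) hab /(boundary_product_near x) hbc.
move=> /(boundary_product_near x) hac.
have [i [[<- <-] <-]] := filter_ex (filterI (filterI hab hbc) hac).
exact: four_point.
Qed.

Lemma boundary_product_min0 x a b c : a <> b -> b <> c -> a <> c ->
  boundary_product x a b = 0 ->
  Num.min (boundary_product x a c) (boundary_product x b c) = 0.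
Proof.
move=> ab bc ac ab0; apply/le_anti/andP; split.
  rewrite -ab0 (boundary_productC x b).
  by apply: boundary_product_ultra => //; exact/nesym.
by rewrite le_min !boundary_product_ge0.
Qed.

(** The limit of the right-hand side is the Busemann function of the end a. *)
Lemma boundary_product_triple x y a b c : a <> b -> b <> c -> a <> c ->
  \forall i \near \oo,
  (boundary_product y a b + boundary_product y a c - boundary_product y b c) -
  (boundary_product x a b + boundary_product x a c - boundary_product x b c) =
  mdist y (boundary_repr a i) - mdist x (boundary_repr a i).
Proof.
move=> ab bc ac.
apply: filterS (filterI (filterI (filterI (boundary_product_near x ab)
  (boundary_product_near x bc)) (boundary_product_near x ac))
  (filterI (filterI (boundary_product_near y ab)
  (boundary_product_near y bc)) (boundary_product_near y ac))) => i.
move=> [[[<- <-] <-] [[<- <-] <-]].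
by rewrite /gromov_product; lra.
Qed.

Lemma boundary_product_triple_le x y a b c : a <> b -> b <> c -> a <> c ->
  (boundary_product y a b + boundary_product y a c - boundary_product y b c) -
  (boundary_product x a b + boundary_product x a c - boundary_product x b c)
  <= mdist x y.
Proof.
move=> ab bc ac.
have [i ->] := filter_ex (boundary_product_triple x y ab bc ac).
have := metric_triangle y x (boundary_repr a i); rewrite (metric_sym y x).
by lra.
Qed.

Hypothesis hXc : geodesically_complete X.

Lemma extend_segment x y : x <> y -> exists g : R -> X,
  [/\ forall s t, mdist (g s) (g t) = `|s - t|, g 0 = x & g (mdist x y) = y].
Proof.
move=> /eqP; rewrite -mdist_gt0 => l0.
have [ex _ _] := hX; have [c [hc c0 c1]] := ex x y.
have [g hg e] := hXc l0 hc; exists g; split.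
- by move=> s t; apply: hg.
- by rewrite e ?c0// in_itv /= lexx ltW.
- by rewrite e ?c1// in_itv /= lexx ltW.
Qed.

Lemma ray_end g x : (forall s t : R, mdist (g s) (g t) = `|s - t|) ->
  exists a, forall A, \forall i \near \oo,
    A <= gromov_product x (g i%:R) (boundary_repr a i).
Proof.
move=> hg; apply: boundary_end; exists (g 0) => A.
have [N _ hN] := nbhs_infty_ger A.
exists N => i j Ni Nj.
have iA := hN i Ni; have jA := hN j Nj.
rewrite /= in iA jA; rewrite /gromov_product !hg !sub0r !normrN !normr_nat.
by case: (lerP i%:R (j%:R : R)) => ?; lra.
Qed.

(** Every point lies on a line joining two ends. *)
Lemma boundary_product_exists0 x a0 : exists a b,
  a <> b /\ boundary_product x a b = 0.
Proof.
have [y xy] : exists y, x <> y.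
  have [i h] := filter_ex (boundary_repr_ge a0 x 1).
  exists (boundary_repr a0 i) => e; have := h i (leqnn i).
  by have := gromov_product_le x (boundary_repr a0 i) (boundary_repr a0 i);
    rewrite -e mdistxx; lra.
have [g [hg g0 _]] := extend_segment xy.
have [a ha] := ray_end x hg.
(* b is the other end of the line g. *)
have [b hb] : exists b, forall A, \forall i \near \oo,
    A <= gromov_product x (g (- i%:R)) (boundary_repr b i).
  apply: (@ray_end (fun t => g (- t))) => s t.
  by rewrite hg distrC; congr `|_|; lra.
have e : \forall i \near \oo,
    gromov_product x (boundary_repr a i) (boundary_repr b i) = 0.
  apply: filterS2 (ha 1) (hb 1) => i h1 h2.
  have e0 : gromov_product x (g i%:R) (g (- i%:R)) = 0.
    rewrite /gromov_product -g0 !hg !sub0r opprK normrN.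
    by rewrite !ger0_norm ?addr_ge0 ?ler0n//; lra.
  by rewrite -e0; apply: gromov_product_stable; rewrite e0; lra.
have nab : a <> b.
  move=> ab; subst b.
  have [i [h1 h2]] := filter_ex (filterI e (boundary_repr_ge a x 1)).
  by have := h2 i (leqnn i); rewrite h1; lra.
exists a, b; split=> //.
by have [i [<- ->]] := filter_ex (filterI (boundary_product_near x nab) e).
Qed.

(** The end a is reached by prolonging the segment from y to x beyond x. *)
Lemma boundary_product_triple_eq x y : x <> y -> exists a, forall b c,
  a <> b -> b <> c -> a <> c ->
  (boundary_product y a b + boundary_product y a c - boundary_product y b c) -
  (boundary_product x a b + boundary_product x a c - boundary_product x b c)
  = mdist x y.
Proof.
move=> /nesym/extend_segment[g [hg g0 g1]].
have [a ha] := ray_end x hg; exists a => b c ab bc ac.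
have [i [[-> h] hi]] := filter_ex (filterI (filterI
  (boundary_product_triple x y ab bc ac) (ha 1)) (nbhs_infty_ger (mdist y x))).
rewrite /= in hi.
have e0 : gromov_product x y (g i%:R) = 0.
  rewrite /gromov_product (metric_sym x y) -[in mdist x _]g1 -[in mdist y (g _)]g0.
  rewrite !hg sub0r normrN normr_nat ler0_norm; lra.
have := four_point hX x y (boundary_repr a i) (g i%:R).
rewrite e0 gromov_productC ge_min (gromov_productC x _ (g _)).
rewrite gromov_productC => /orP[|]; last lra.
have := gromov_product_ge0 x y (boundary_repr a i).
by rewrite /gromov_product; lra.
Qed.

(** The line joining a and b contains points p with arbitrary position s
    relative to the end c.  Such a point is found on the segment between the
    i-th terms of representing sequences: the distance from p to the base point
    is bounded independently of i, so for i large p lies on the line itself. *)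
Lemma boundary_product_line a b c s : a <> b -> b <> c -> a <> c ->
  exists p, boundary_product p a b = 0 /\
    boundary_product p a c - boundary_product p b c = s.
Proof.
move=> ab bc ac; pose o := boundary_repr a 0%N.
have ab0 := boundary_product_ge0 o ab; have ac0 := boundary_product_ge0 o ac.
have bc0 := boundary_product_ge0 o bc.
pose S := boundary_product o a b + boundary_product o a c +
  boundary_product o b c.
pose K := `|s| + S.
pose A := 2 * K + S + 1.
have [i [[[[[eab ebc] eac] ha] hb] hc]] := filter_ex (filterI (filterI (filterI
  (filterI (filterI (boundary_product_near o ab) (boundary_product_near o bc))
  (boundary_product_near o ac))
  (boundary_repr_ge a o A)) (boundary_repr_ge b o A)) (boundary_repr_ge c o A)).
set ai := boundary_repr a i in eab eac ha *.
set bi := boundary_repr b i in eab ebc hb *.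
set ci := boundary_repr c i in eac ebc hc *.
have da : A <= mdist o ai by apply: le_trans (ha i _) (gromov_product_le _ _ _).
have db : A <= mdist o bi by apply: le_trans (hb i _) (gromov_product_le _ _ _).
have s1 := ler_norm s; have s2 := ler_norm (- s); rewrite normrN in s2.
have [ex _ _] := hX; have [g gg] := ex ai bi.
(* The point at distance t from ai on the segment satisfies
   (ai|ci)_p - (bi|ci)_p = t - (bi|ci)_ai. *)
pose t := s + gromov_product ai bi ci.
have ht : 0 <= t <= mdist ai bi.
  move: eab ebc eac; rewrite /t /gromov_product (metric_sym ai ci).
  rewrite (metric_sym ai bi) (metric_sym bi ci).
  rewrite /A /K /S in da db *; lra.
pose p := g t.
have dpa := geodesic_dist gg ht; have dpb := geodesic_dist_end gg ht.
rewrite -/p in dpa dpb.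
rewrite metric_sym in dpa.
have dop : mdist o p <= K.
  have := four_point hX p ai o bi; rewrite /gromov_product dpa dpb ge_min.
  rewrite (metric_sym p o) (metric_sym ai o).
  move: eab ebc eac; rewrite /t /gromov_product /K /S; lra.
have stable q q1 r r1 : gromov_product o q r <= S ->
    A <= gromov_product o q q1 -> A <= gromov_product o r r1 ->
    gromov_product p q1 r1 = gromov_product p q r.
  move=> hqr hq hr; apply: gromov_product_stable.
    have := gromov_product_base o p q q1; have := gromov_product_base p o q r.
    by rewrite (metric_sym p o) /A in hq *; lra.
  have := gromov_product_base o p r r1; have := gromov_product_base p o q r.
  by rewrite (metric_sym p o) /A in hr *; lra.
exists p.
have [j [[[<- <-] <-] ij]] := filter_ex (filterI (filterI (filterI
  (boundary_product_near p ab) (boundary_product_near p ac))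
  (boundary_product_near p bc)) (nbhs_infty_ge i)).
rewrite /= in ij.
rewrite (stable _ _ _ _ _ (ha _ ij) (hb _ ij)); last by rewrite eab /S; lra.
rewrite (stable _ _ _ _ _ (ha _ ij) (hc _ ij)); last by rewrite eac /S; lra.
rewrite (stable _ _ _ _ _ (hb _ ij) (hc _ ij)); last by rewrite ebc /S; lra.
rewrite /gromov_product dpa dpb; split; first by lra.
by rewrite /t /gromov_product; lra.
Qed.

End Boundary.

(** * The Moebius bijection of the boundaries *)

Section Bourdon.
Context {R : realType} {X : metricType R} (hX : tree X).
Implicit Types (x : X) (a b c : boundary X).

Lemma bourdonE x a b : a <> b ->
  bourdon x a b = (expR (- boundary_product x a b))%:E.
Proof. by move=> ab; rewrite /bourdon asboolF. Qed.

Lemma bourdonxx x a : bourdon x a a = 0%E.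
Proof. by rewrite /bourdon asboolT. Qed.

Lemma bourdon_extended_metric x : extended_metric (bourdon x).
Proof.
have ge0 a b : (0 <= bourdon x a b)%E.
  have [->|ab] := pselect (a = b); first by rewrite bourdonxx.
  by rewrite bourdonE// lee_fin expR_ge0.
split=> //.
  move=> a b; have [->//|ab] := pselect (a = b).
  by rewrite !bourdonE//; [rewrite boundary_productC|exact/nesym].
exists set0; split=> //; [by left|split].
- move=> a b _ _; have [->|ab] := pselect (a = b); first by rewrite bourdonxx.
  by rewrite bourdonE// ltry.
- move=> a b _ _; split=> [|->]; last by rewrite bourdonxx.
  have [//|ab] := pselect (a = b); rewrite bourdonE// => -[e].
  by have := expR_gt0 (- boundary_product x a b); rewrite e ltxx.
- move=> a b c _ _ _.
  have [->|ab] := pselect (a = b); first by rewrite bourdonxx add0e.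
  have [<-|bc] := pselect (b = c); first by rewrite bourdonxx adde0.
  have [->|ac] := pselect (a = c); first by rewrite bourdonxx adde_ge0.
  rewrite !bourdonE// -EFinD lee_fin.
  have := boundary_product_ultra hX x ab bc ac; rewrite ge_min.
  have e1 := expR_ge0 (- boundary_product x a b).
  have e2 := expR_ge0 (- boundary_product x b c).
  have dec t : t <= boundary_product x a c ->
      expR (- boundary_product x a c) <= expR (- t).
    by move=> le; rewrite ler_expR lerN2.
  by case/orP => /dec ?; lra.
Qed.

Lemma bourdon_canonical x : canonical_moebius X (bourdon x).
Proof.
exists x => //; split; first exact: bourdon_extended_metric.
move=> a b c d _; exists 1; first exact: oner_neq0.
by rewrite !mul1r.
Qed.

Lemma crt_factor_bourdon x a b : a <> b ->
  crt_factor (bourdon x) a b = expR (- boundary_product x a b).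
Proof. by move=> ab; rewrite /crt_factor bourdonE. Qed.

End Bourdon.

(** Preservation of the cross ratios in additive form: minus the logarithm of the
    quotient of the first two coordinates of the cross ratio triple, for the
    Bourdon metrics at arbitrary points.  The products of ends are meaningful
    only for distinct ends, whence the hypotheses; a = d and b = c are
    harmless. *)
Definition preserves_cross_difference {R : realType} {X X' : metricType R}
    (F : boundary X -> boundary X') : Prop :=
  forall (x : X) (x' : X') a b c d, a <> b -> c <> d -> a <> c -> b <> d ->
    boundary_product x' (F a) (F b) + boundary_product x' (F c) (F d) -
    boundary_product x' (F a) (F c) - boundary_product x' (F b) (F d) =
    boundary_product x a b + boundary_product x c d -
    boundary_product x a c - boundary_product x b d.

Lemma moebius_bijection (R : realType) (Z : Type) (M : set (Z -> Z -> \bar R))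
    (X X' : metricType R) : moebius_space M -> tree X -> tree X' ->
  moebius_equivalent_spaces (canonical_moebius X) M ->
  moebius_equivalent_spaces (canonical_moebius X') M ->
  exists2 F : boundary X -> boundary X', bijective F &
    preserves_cross_difference F.
Proof.
move=> [_ [rho hrho eM]] hX hX' [f bf [_ hf]] [f' bf' [_ hf']].
have Mrho : M rho.
  rewrite eM; split=> // x y z w _; exists 1; first exact: oner_neq0.
  by rewrite !mul1r.
have [h hK Kh] := bf'.
have bF : bijective (h \o f).
  by apply: bij_comp => //; exact: Bijective Kh hK.
exists (h \o f) => // x x' a b c d ab cd ac bd.
have injF := bij_inj bF.
have adm : admissible a b c d.
  by split=> -[e1 e2]; subst.
have adm' : admissible (h (f a)) (h (f b)) (h (f c)) (h (f d)).
  by split=> -[/injF e1 /injF e2]; subst.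
have nF (u v : boundary X) : u <> v -> h (f u) <> h (f v).
  by move=> uv /injF.
have [l l0 e] := hf _ _ (bourdon_canonical hX x) Mrho _ _ _ _ adm.
have [l' l'0 e'] := hf' _ _ (bourdon_canonical hX' x') Mrho _ _ _ _ adm'.
move: e'; rewrite !Kh e /crt /= => -[].
rewrite (crt_factor_bourdon x ab) (crt_factor_bourdon x cd).
rewrite (crt_factor_bourdon x ac) (crt_factor_bourdon x bd).
rewrite (crt_factor_bourdon x' (nF _ _ ab)) (crt_factor_bourdon x' (nF _ _ cd)).
rewrite (crt_factor_bourdon x' (nF _ _ ac)) (crt_factor_bourdon x' (nF _ _ bd)).
rewrite -!expRD => e1 e2 _.
set A := - _ + - _ in e1; set A' := - _ + - _ in e1.
set B := - _ + - _ in e2; set B' := - _ + - _ in e2.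
suff eAB : A + B' = A' + B by move: eAB; rewrite /A /A' /B /B' /=; lra.
apply: expR_inj; rewrite (expRD A) (expRD A').
apply: (mulfI l0); rewrite mulrA e1 -mulrA (mulrCA l) e2.
by rewrite (mulrCA l').
Qed.

(** * Corresponding points of the two trees *)

(** The points x and x' see the ends in the same way: F is an isometry from the
    Bourdon metric at x to the Bourdon metric at x'. *)
Definition corresponds {R : realType} {X X' : metricType R}
    (F : boundary X -> boundary X') (x : X) (x' : X') : Prop :=
  forall a b, a <> b ->
    boundary_product x' (F a) (F b) = boundary_product x a b.

Lemma third_point (T : Type) (a b : T) : at_least_three_points T ->
  exists c, a <> c /\ b <> c.
Proof.
move=> [p [q [r [pq pr qr]]]].
have [ap|ap] := pselect (a = p); have [bp|bp] := pselect (b = p).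
- by exists q; subst.
- have [bq|bq] := pselect (b = q); first by exists r; subst.
  by exists q; subst.
- have [aq|aq] := pselect (a = q); first by exists r; subst.
  by exists q; subst.
- by exists p.
Qed.

(** Two numbers whose minimum is 0 are determined by their difference. *)
Lemma eq_of_min0 (R : realDomainType) (u v u' v' : R) :
  Num.min u v = 0 -> Num.min u' v' = 0 -> u - v = u' - v' -> u = u' /\ v = v'.
Proof. by case: lerP => ? ?; case: lerP => ? ? ?; split; lra. Qed.

Section Correspondence.
Context {R : realType} {X X' : metricType R}.
Hypotheses (hX : tree X) (hX' : tree X').
Hypotheses (hXc : geodesically_complete X) (hXn : nonelementary X).
Variable F : boundary X -> boundary X'.
Hypothesis injF : injective F.

Lemma corresponds_exists : preserves_cross_difference F ->
  forall x, exists x', corresponds F x x'.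
Proof.
move=> cdF x.
have [a0 _] := hXn.
have [a [b [ab ab0]]] := boundary_product_exists0 hX hXc x a0.
have nF u v : u <> v -> F u <> F v by move=> uv /injF.
have [c [ac bc]] := third_point a b hXn.
have [x' [ab0' e']] := boundary_product_line hX'
  (boundary_product x a c - boundary_product x b c) (nF _ _ ab) (nF _ _ bc)
  (nF _ _ ac).
have min0 u : a <> u -> b <> u -> Num.min (boundary_product x a u)
    (boundary_product x b u) = 0.
  by move=> au bu; apply: boundary_product_min0.
have min0' u : a <> u -> b <> u -> Num.min (boundary_product x' (F a) (F u))
    (boundary_product x' (F b) (F u)) = 0.
  by move=> au bu; apply: boundary_product_min0; rewrite ?ab0'//; exact: nF.
have ec := eq_of_min0 (min0' c ac bc) (min0 c ac bc) e'.
(* Cross differences transfer the difference of the products with a and b from c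
   to every other end u. *)
have eu u : a <> u -> b <> u ->
    boundary_product x' (F a) (F u) = boundary_product x a u /\
    boundary_product x' (F b) (F u) = boundary_product x b u.
  move=> au bu; apply: eq_of_min0 (min0' u au bu) (min0 u au bu) _.
  have := cdF x x' a u c b au (nesym bc) ac (nesym bu).
  rewrite !(boundary_productC _ c b) !(boundary_productC _ u b).
  rewrite !(boundary_productC _ (F c) (F b)) !(boundary_productC _ (F u) (F b)).
  by lra.
have ea u : a <> u -> boundary_product x' (F a) (F u) = boundary_product x a u.
  move=> au; have [<-|bu] := pselect (b = u); first by rewrite ab0 ab0'.
  by have [] := eu u au bu.
have eb u : b <> u -> boundary_product x' (F b) (F u) = boundary_product x b u.
  move=> bu; have [<-|au] := pselect (a = u); last by have [] := eu u au bu.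
  by rewrite boundary_productC (boundary_productC x) ab0 ab0'.
exists x' => u v uv.
have [e|au] := pselect (a = u); first by subst u; apply: ea.
have [e|bu] := pselect (b = u); first by subst u; apply: eb.
have [e|av] := pselect (a = v).
  by subst v; rewrite boundary_productC (boundary_productC x); apply: ea.
have [e|bv] := pselect (b = v).
  by subst v; rewrite boundary_productC (boundary_productC x); apply: eb.
have := cdF x x' a b u v ab uv au bv.
rewrite ab0 ab0' ea// eb//; lra.
Qed.

(** The distance of x and y is attained by a triple of ends, and triples of
    ends bound the distance of x' and y' from below. *)
Lemma corresponds_dist_le x y x' y' : corresponds F x x' ->
  corresponds F y y' -> mdist x y <= mdist x' y'.
Proof.
move=> cx cy; have [->|xy] := pselect (x = y); first by rewrite mdistxx mdist_ge0.
have nF u v : u <> v -> F u <> F v by move=> uv /injF.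
have [a ha] := boundary_product_triple_eq hX hXc xy.
have [b [ab _]] := third_point a a hXn.
have [c [ac bc]] := third_point a b hXn.
rewrite -(ha b c ab bc ac) -!cx// -!cy//.
by apply: boundary_product_triple_le => //; exact: nF.
Qed.

End Correspondence.

Lemma corresponds_inv (R : realType) (X X' : metricType R)
    (F : boundary X -> boundary X') G x x' : cancel G F ->
  corresponds F x x' -> corresponds G x' x.
Proof.
move=> GK cx a b ab; rewrite -cx ?GK//.
by move=> /(congr1 F); rewrite !GK.
Qed.

Theorem corollary4p4 (R : realType) (Z : Type) (M : set (Z -> Z -> \bar R))
    (hM : moebius_space M) (hMc : complete_moebius M)
    (hMu : ultrametric_moebius M)
    (X X' : metricType R)
    (hX : tree X) (hXc : geodesically_complete X) (hXn : nonelementary X)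
    (hX' : tree X') (hXc' : geodesically_complete X') (hXn' : nonelementary X')
    (hXM : moebius_equivalent_spaces (canonical_moebius X) M)
    (hXM' : moebius_equivalent_spaces (canonical_moebius X') M) :
  isometric_spaces X X'.
Proof.
have [F bF cdF] := moebius_bijection hM hX hX' hXM hXM'.
have [G FK GK] := bF.
have injF := can_inj FK; have injG := can_inj GK.
have cdG : preserves_cross_difference G.
  move=> x' x a b c d ab cd ac bd.
  have nG u v : u <> v -> G u <> G v by move=> uv /injG.
  by rewrite -(cdF x x') ?GK//; exact: nG.
have [phi hphi] := choice (corresponds_exists hX hX' hXc hXn injF cdF).
have [psi hpsi] := choice (corresponds_exists hX' hX hXc' hXn' injG cdG).
have isoF x y x' y' : corresponds F x x' -> corresponds F y y' ->
    mdist x' y' = mdist x y.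
  move=> cx cy; apply/le_anti/andP; split.
    exact: (corresponds_dist_le hX' hX hXc' hXn' injG
      (corresponds_inv GK cx) (corresponds_inv GK cy)).
  exact: (corresponds_dist_le hX hX' hXc hXn injF cx cy).
have hpsi' x' : corresponds F (psi x') x' by exact: corresponds_inv FK (hpsi x').
exists phi; last by move=> x y; exact: isoF.
exists psi => x; apply: mdist_positivity.
  by rewrite -(isoF _ _ _ _ (hpsi' (phi x)) (hphi x)) mdistxx.
by rewrite (isoF _ _ _ _ (hphi (psi x)) (hpsi' x)) mdistxx.
Qed.
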